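(* Let $G=(V,E)$ be a finite strongly connected directed graph on $n$ nodes with transition matrix $H$, and consider the pull voter model with agnostic nodes on $G$ with matrix $H$ (either synchronous or asynchronous). Let $S_0$ be the starting configuration. Let $T_c$ be the time it takes for consensus to be achieved and let $T_a$ be the time it takes for the agnostic vertices to disappear. Let $f(n)\in[0,\infty]$ be an upper bound on the expected time for consensus to be reached on $G$ in the classical voter model (with the same matrix $H$ and the same synchronous/asynchronous update, and without any agnostic vertices), valid for every initial configuration. Then $$\mathbb{E}(T_c\mid S_0)\le \mathbb{E}(T_a\mid S_0)+f(n).$$
   Context: Setting. $G=(V,E)$ is a finite strongly connected directed graph (self-loops allowed), $n=|V|$. The transition matrix $H$ is a row-stochastic $V\times V$ matrix with $H(v,u)>0$ if $(v,u)\in E$ and $H(v,u)=0$ otherwise. Pull voter model with agnostic nodes. Each node is, at each time, either agnostic (no colour) or gnostic; gnostic nodes are coloured red or blue. In the synchronous version, at each round every node $v$ independently selects an out-neighbour $u$ with probability $H(v,u)$. If $u$ is agnostic, $v$ keeps its current state; if $u$ is gnostic, $v$ copies the colour of $u$. All updates use the states at the start of the round and occur simultaneously. In the asynchronous version, at each round one node $v$ is chosen uniformly at random from $V$, it alone selects an out-neighbour (with probabilities $H(v,\cdot)$) and updates by the same rule; all other nodes keep their state. The classical voter model is the same process started from a configuration with no agnostic nodes. Consensus means that all nodes have the same gnostic colour. $T_c$ is the first time $t$ at which the configuration is a consensus and $T_a$ is the first time $t$ at which no node is agnostic (each $\infty$ if this never happens). *)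

(* Defs.v *)
From HB Require Import structures.
From mathcomp Require Import all_boot all_order all_algebra.
From mathcomp Require Import all_classical all_reals all_analysis.

Set Implicit Arguments.
Unset Strict Implicit.
Unset Printing Implicit Defensive.

Local Open Scope classical_set_scope.
Local Open Scope ring_scope.

Definition strongly_connected (V : finType) (E : rel V) : Prop :=
  forall u v : V, connect E u v.

Definition transition_matrix (R : realType) (V : finType) (E : rel V)
    (H : V -> V -> R) : Prop :=
  [/\ forall v u : V, E v u -> 0 < H v u,
      forall v u : V, ~~ E v u -> H v u = 0
    & forall v : V, \sum_(u : V) H v u = 1].

Variant colour := Red | Blue.

Definition bool_of_colour (c : colour) : bool := if c is Red then true else false.
Definition colour_of_bool (b : bool) : colour := if b then Red else Blue.
Lemma bool_of_colourK : cancel bool_of_colour colour_of_bool.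
Proof. by case. Qed.
HB.instance Definition _ := Finite.copy colour (can_type bool_of_colourK).

(* [None] is the agnostic state, [Some c] the gnostic state of colour [c]. *)
Definition config (V : finType) := {ffun V -> option colour}.

Definition consensus (V : finType) : set (config V) :=
  [set S | exists c : colour, forall v : V, S v = Some c].

Definition no_agnostic (V : finType) : set (config V) :=
  [set S | forall v : V, S v <> None].

Definition pull (own other : option colour) : option colour :=
  if other is Some c then Some c else own.

Variant update_mode := Synchronous | Asynchronous.

(* The random choice made in one round: synchronously, the out-neighbour [d v]
   selected by each node [v]; asynchronously, a pair [(v, u)] of the active node
   [v] and the out-neighbour [u] that it selects. *)
Definition selection (mode : update_mode) (V : finType) : finType :=
  match mode with
  | Synchronous => {ffun V -> V}
  | Asynchronous => (V * V)%type
  end.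

Definition selection_law (R : realType) (V : finType) (H : V -> V -> R)
    (mode : update_mode) : selection mode V -> R :=
  match mode return selection mode V -> R with
  | Synchronous => fun d : {ffun V -> V} => \prod_(v : V) H v (d v)
  | Asynchronous => fun d : V * V => #|V|%:R^-1 * H d.1 d.2
  end.

Definition step (V : finType) (mode : update_mode) :
    selection mode V -> config V -> config V :=
  match mode return selection mode V -> config V -> config V with
  | Synchronous => fun (d : {ffun V -> V}) S =>
      [ffun v => pull (S v) (S (d v))]
  | Asynchronous => fun (d : V * V) S =>
      [ffun v => if v == d.1 then pull (S v) (S d.2) else S v]
  end.

Fixpoint voter (V : finType) (mode : update_mode) (x : nat -> selection mode V)
    (S0 : config V) (t : nat) : config V :=
  if t is t'.+1 then step (x t') (voter x S0 t') else S0.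

(* [ereal_inf] of the empty set is [+oo]: the hitting time of a set that is
   never reached is infinite. *)
Definition hitting_time (R : realType) (C : Type) (A : set C) (s : nat -> C) :
    \bar R :=
  ereal_inf [set t%:R%:E | t in [set t | A (s t)]].

(* The state space [D] carries its discrete sigma-algebra. *)
Definition iid_with_law (R : realType) (d : measure_display)
    (T : measurableType d) (P : probability T R) (D : finType) (law : D -> R)
    (X : nat -> T -> D) : Prop :=
  [/\ forall (t : nat) (A : set D), measurable (X t @^-1` A),
      forall (t : nat) (a : D), P (X t @^-1` [set a]) = (law a)%:E
    & forall (J : seq nat) (A : nat -> set D), uniq J ->
        P (\bigcap_(t in [set t | t \in J]) (X t @^-1` A t)) =
        (\prod_(t <- J) P (X t @^-1` A t))%E].

Definition voter_selections (R : realType) (d : measure_display)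
    (T : measurableType d) (P : probability T R) (V : finType)
    (H : V -> V -> R) (mode : update_mode) (X : nat -> T -> selection mode V) :
    Prop :=
  iid_with_law P (@selection_law R V H mode) X.

Definition expected_time (R : realType) (d : measure_display)
    (T : measurableType d) (P : probability T R) (V : finType)
    (mode : update_mode) (X : nat -> T -> selection mode V)
    (A : set (config V)) (S0 : config V) : \bar R :=
  (\int[P]_w hitting_time R A (voter (fun t => X t w) S0))%E.

(* Main.v *)
Require Import Defs.
From mathcomp Require Import all_boot all_order all_algebra.
From mathcomp Require Import all_classical all_reals all_analysis.
From mathcomp Require Import measurable_realfun.

(** Let T_a = k and C = S_k be the time and the configuration at which the last
    agnostic node disappears. From then on the process is a classical voter
    model started at C and driven by the selections made after round k, so T_c
    is at most k plus its consensus time. The event {T_a = k, S_k = C} depends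
    only on the first k selections, hence is independent of that consensus time,
    whose mean is at most f(n); summing over (k, C) gives E T_c <= E T_a + f(n).
    Hitting times are handled as the series of the indicators of {T > t}, events
    which depend on finitely many selections. *)

Set Implicit Arguments.
Unset Strict Implicit.
Unset Printing Implicit Defensive.

Import Order.TTheory GRing.Theory Num.Theory.

Local Open Scope classical_set_scope.
Local Open Scope ring_scope.

(** * Independence of past and future in an i.i.d. sequence over a finite alphabet *)

Lemma measure_bigcup_finType (R : realType) (d : measure_display)
    (T : measurableType d) (mu : {measure set T -> \bar R}) (I : finType)
    (Q : pred I) (F : I -> set T) :
  (forall i, measurable (F i)) -> trivIset setT F ->
  mu (\bigcup_(i in [set i | Q i]) F i) = (\sum_(i | Q i) mu (F i))%E.
Proof.
move=> mF tF; rewrite measure_fin_bigcup //; last first.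
- exact: sub_trivIset tF.
- exact: finite_finset.
by rewrite (@bigfs _ _ _ _ _ Q) ?index_enum_uniq// => i _; rewrite mem_index_enum.
Qed.

Definition word (D T : Type) (X : nat -> T -> D) (k m : nat) (w : T) : seq D :=
  [seq X i w | i <- iota k m].

(** One implication suffices, since agreement below [m] is symmetric in [x] and [y]. *)
Definition determined (D : Type) (m : nat) (g : set (nat -> D)) : Prop :=
  forall x y, (forall i, (i < m)%N -> x i = y i) -> g x -> g y.

Section IID.
Context (R : realType) (d : measure_display) (T : measurableType d)
  (P : probability T R) (D : finType) (law : D -> R) (X : nat -> T -> D)
  (hX : iid_with_law P law X).

(** An intersection over distinct times is what the product rule of [iid_with_law] applies to; [a]
    is only the default of [nth] and is never reached. *)
Lemma word_eventE k (s : seq D) (a : D):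
  [set w | word X k (size s) w = s] =
  \bigcap_(t in [set t | t \in iota k (size s)])
    (X t @^-1` [set nth a s (t - k)%N]).
Proof.
apply/seteqP; split => w /=.
  move=> e t /=; rewrite mem_iota => /andP[kt tk].
  have h : (t - k < size s)%N by rewrite ltn_subLR.
  rewrite -[in RHS]e (nth_map 0%N) ?size_iota// nth_iota// subnKC//.
move=> h; apply: (@eq_from_nth _ a); rewrite size_map size_iota// => i hi.
rewrite (nth_map 0%N) ?size_iota// nth_iota//.
have := h (k + i)%N; rewrite /= addKn => -> //.
by rewrite mem_iota leq_addr ltn_add2l.
Qed.

Lemma measurable_word k (s : seq D) :
  measurable [set w | word X k (size s) w = s].
Proof.
case: hX => mX _ _; case: s => [|a s].
  by rewrite (_ : [set _ | _] = setT)//; apply/seteqP.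
rewrite (word_eventE _ _ a); exact: fin_bigcap_measurable.
Qed.

Lemma probability_word k (s : seq D) :
  P [set w | word X k (size s) w = s] = (\prod_(a <- s) law a)%:E.
Proof.
case: hX => mX lX iX; case: s => [|a s0].
  rewrite big_nil (_ : [set _ | _] = setT) ?probability_setT//; exact/seteqP.
set s := a :: s0.
rewrite (word_eventE _ _ a).
rewrite (iX (iota k (size s)) (fun t => [set nth a s (t - k)%N])) ?iota_uniq//.
rewrite -[k]addn0 iotaDl big_map [in RHS](big_nth a) -prodEFin /index_iota subn0.
by apply: eq_bigr => i _; rewrite lX addn0 addKn.
Qed.

(** As a boolean predicate on tuples, it splits a determined event into finitely many disjoint word
    events. *)
Let words_of m (g : set (nat -> D)) (s : m.-tuple D) : bool :=
  `[< exists2 x, [seq x i | i <- iota 0 m] = s & g x >].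

Lemma words_ofP k m (g : set (nat -> D)) w : determined m g ->
  g (fun i => X (k + i) w) <->
  exists2 s : m.-tuple D, words_of g s & word X k m w = s.
Proof.
move=> dg; have sz : size (word X k m w) == m by rewrite size_map size_iota.
have we : word X k m w = [seq X (k + i) w | i <- iota 0 m].
  by rewrite /word -[k in iota k]addn0 iotaDl -map_comp.
split=> [gw|[s /asboolP[x xs gx] ws]].
  exists (Tuple sz) => //; apply/asboolP.
  by exists (fun i => X (k + i) w).
apply: dg gx => i im.
have /(congr1 (fun u => nth (x i) u i)) :
    [seq x i | i <- iota 0 m] = [seq X (k + i) w | i <- iota 0 m].
  by rewrite xs -ws we.
by rewrite !(nth_map 0%N) ?size_iota// nth_iota// add0n.
Qed.

Lemma trivIset_word (I : Type) k m (F : I -> seq D) : injective F ->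
  trivIset setT (fun i => [set w | word X k m w = F i]).
Proof. by move=> injF i j _ _ [w /= [-> /injF]]. Qed.

Let event_bigcup k m (g : set (nat -> D)) : determined m g ->
  [set w | g (fun i => X (k + i) w)] =
  \bigcup_(s in [set s : m.-tuple D | words_of g s]) [set w | word X k m w = s].
Proof. by move=> dg; apply/seteqP; split=> w /= /(words_ofP k w dg). Qed.

Let measurable_word_tuple k m (s : m.-tuple D) :
  measurable [set w | word X k m w = s].
Proof. by have := measurable_word k s; rewrite size_tuple. Qed.

Lemma measurable_determined k m (g : set (nat -> D)) : determined m g ->
  measurable [set w | g (fun i => X (k + i) w)].
Proof.
move=> dg; rewrite (event_bigcup k dg).
by apply: fin_bigcup_measurable => // s _; exact: measurable_word_tuple.
Qed.

(** The right-hand side is free of [k]: this is the stationarity of the selections. *)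
Let probability_determined k m (g : set (nat -> D)) : determined m g ->
  P [set w | g (fun i => X (k + i) w)] =
  (\sum_(s : m.-tuple D | words_of g s) \prod_(a <- s) law a)%:E.
Proof.
move=> dg; rewrite (event_bigcup k dg) measure_bigcup_finType.
- rewrite -sumEFin; apply: eq_bigr => s _.
  by rewrite -(probability_word k) size_tuple.
- by move=> s; exact: measurable_word_tuple.
- by apply: trivIset_word; exact: val_inj.
Qed.

Lemma determined_shift k m (g h : set (nat -> D)) :
  determined k g -> determined m h ->
  determined (k + m) [set x | g x /\ h (fun i => x (k + i))].
Proof.
move=> dg dh x y xy [gx hx]; split.
  by apply: dg gx => i ik; apply: xy; rewrite ltn_addr.
by apply: dh hx => i im; apply: xy; rewrite ltn_add2l.
Qed.

(** A word of length [k + m] splits uniquely into a past and a future word, and its weight is the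
    product of theirs, so the sum over pairs factors. By stationarity the future factor can be
    written with unshifted selections. *)
Lemma probability_past_future k m (g h : set (nat -> D)) :
  determined k g -> determined m h ->
  P [set w | g (fun i => X i w) /\ h (fun i => X (k + i) w)] =
  (P [set w | g (fun i => X i w)] * P [set w | h (fun i => X i w)])%E.
Proof.
move=> dg dh; rewrite (probability_determined 0 dg) (probability_determined 0 dh).
have -> : [set w | g (fun i => X i w) /\ h (fun i => X (k + i) w)] =
  \bigcup_(p in [set p : k.-tuple D * m.-tuple D |
      words_of g p.1 && words_of h p.2])
    [set w | word X 0 (k + m) w = p.1 ++ p.2].
  apply/seteqP; split=> w /=.
    move=> [/(words_ofP 0 w dg)[s gs ws] /(words_ofP k w dh)[s' hs' ws']].
    exists (s, s'); first by rewrite /= gs.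
    by rewrite /= /word iotaD map_cat -ws -ws'.
  move=> [[s s'] /= /andP[gs hs']] /eqP.
  rewrite /word iotaD map_cat eqseq_cat ?size_map ?size_iota ?size_tuple//.
  move=> /andP[/eqP ws /eqP ws']; split.
    by apply/(words_ofP 0 w dg); exists s.
  by apply/(words_ofP k w dh); exists s'.
have pE (p : k.-tuple D * m.-tuple D) : (k + m)%N = size (p.1 ++ p.2).
  by rewrite size_cat !size_tuple.
rewrite measure_bigcup_finType.
- rewrite -EFinM big_distrlr pair_big_dep/= -sumEFin.
  apply: eq_bigr => p _.
  by rewrite (pE p) probability_word big_cat.
- by move=> p; rewrite (pE p); exact: measurable_word.
- apply: trivIset_word => -[s s'] [u u'] /= /eqP.
  by rewrite eqseq_cat ?size_tuple// => /andP[/eqP/val_inj-> /eqP/val_inj->].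
Qed.

End IID.

(** * Hitting times in discrete time *)

(** For T the hitting time of [A], this is the event T > t; [first_hit A k] is T = k. *)
Definition avoids (C : Type) (A : set C) (t : nat) : set (nat -> C) :=
  [set s | forall u, (u <= t)%N -> ~ A (s u)].

Definition first_hit (C : Type) (A : set C) (k : nat) : set (nat -> C) :=
  [set s | A (s k) /\ forall u, (u < k)%N -> ~ A (s u)].

Lemma first_hit_or_never (C : Type) (A : set C) (s : nat -> C) :
  (exists k, first_hit A k s) \/ forall t, ~ A (s t).
Proof.
have [[t At]|/forallNP] := pselect (exists t, A (s t)); last by right.
left; have ex : exists t, `[< A (s t) >] by exists t; apply/asboolP.
case: (ex_minnP ex) => k /asboolP Ak kmin; exists k; split => // u uk /asboolP Au.
by have := kmin _ Au; rewrite leqNgt uk.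
Qed.

Section HittingTime.
Context (R : realType) (C : Type) (A : set C).
Implicit Types s : nat -> C.

Lemma hitting_time_ge0 s : (0 <= hitting_time R A s)%E.
Proof. by apply: le_ereal_inf_tmp => _ [t _ <-]; rewrite lee_fin. Qed.

Lemma hitting_time_le s t : A (s t) -> (hitting_time R A s <= t%:R%:E)%E.
Proof. by move=> At; apply: ge_ereal_inf; exists t%:R%:E => //; exists t. Qed.

Lemma hitting_time_first_hit k s : first_hit A k s ->
  hitting_time R A s = k%:R%:E.
Proof.
move=> [Ak kmin]; apply/eqP; rewrite eq_le (hitting_time_le Ak)/=.
apply: le_ereal_inf_tmp => _ [t /= At <-]; rewrite lee_fin ler_nat leqNgt.
by apply/negP => /kmin.
Qed.

Lemma hitting_time_never s : (forall t, ~ A (s t)) ->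
  hitting_time R A s = +oo%E.
Proof.
move=> nA; rewrite /hitting_time (_ : [set _ | _ in _] = set0) ?ereal_inf0//.
by apply/seteqP; split=> // y [t At]; case: (nA t At).
Qed.

(** Only an inequality, because [A] may already have been visited before time [k]. *)
Lemma hitting_time_shift_le k s :
  (hitting_time R A s <=
   k%:R%:E + hitting_time R A (fun t => s (k + t)%N))%E.
Proof.
have [[t At]|nA] := first_hit_or_never A (fun t => s (k + t)%N); last first.
  by rewrite (hitting_time_never nA) addey// leey.
rewrite (hitting_time_first_hit At) -EFinD -natrD.
by apply: hitting_time_le; case: At.
Qed.

(** If T = k, the terms below [k] are 1 and the others vanish; if T is infinite, every term is 1. *)
Lemma hitting_time_series s :
  hitting_time R A s = (\sum_(0 <= t <oo) (\1_(avoids A t) s)%:E)%E.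
Proof.
have initial_sum k : (forall u, (u < k)%N -> ~ A (s u)) ->
    (\sum_(0 <= t < k) (\1_(avoids A t) s)%:E = k%:R%:E :> \bar R)%E.
  move=> nA; rewrite sumEFin (eq_big_nat _ _ (F2 := fun=> 1)).
    by rewrite sumr_const_nat subn0.
  move=> t /andP[_ tk]; rewrite indicE mem_set//= => u ut.
  by apply: nA; exact: leq_ltn_trans tk.
have [[k [Ak nA]]|nA] := first_hit_or_never A s.
  rewrite (hitting_time_first_hit (conj Ak nA)) (nneseries_split 0 k)// add0n.
  rewrite initial_sum// eseries0 ?adde0// => t kt _.
  by rewrite indicE memNset//= => /(_ k kt).
(* The series exceeds any real [r], since [Num.bound r] terms already do. *)
rewrite (hitting_time_never nA); apply/esym/eqyP => r r0.
rewrite (le_trans _ (nneseries_lim_ge (Num.bound r) _))//.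
by rewrite initial_sum// lee_fin ltW// archi_boundP// ltW.
Qed.

End HittingTime.

(** * Restarting the voter process, and its dependence on finitely many selections *)

Lemma voter_shift (V : finType) (mode : update_mode)
    (x : nat -> selection mode V) (S0 : config V) (k t : nat) :
  voter x S0 (k + t) = voter (fun i => x (k + i)%N) (voter x S0 k) t.
Proof. by elim: t => [|t IH]; rewrite ?addn0// addnS /= IH. Qed.

Lemma voter_agree (V : finType) (mode : update_mode)
    (x y : nat -> selection mode V) (S0 : config V) (t : nat) :
  (forall i, (i < t)%N -> x i = y i) -> voter x S0 t = voter y S0 t.
Proof.
elim: t => //= t IH xy; rewrite IH ?xy// => i it.
by apply: xy; exact: ltnW.
Qed.

(** Time [t] is included, yet [t] selections suffice: the configuration at time [u] uses only those
    of index below [u]. *)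
Lemma determined_avoids (V : finType) (mode : update_mode)
    (A : set (config V)) (S0 : config V) (t : nat) :
  determined t [set x : nat -> selection mode V | avoids A t (voter x S0)].
Proof.
move=> x y xy nA u ut; rewrite -(@voter_agree _ _ x) ?nA//.
  by apply: nA.
by move=> i iu; apply: xy; exact: leq_trans ut.
Qed.

Lemma determined_first_hit (V : finType) (mode : update_mode)
    (A : set (config V)) (S0 S1 : config V) (k : nat) :
  determined k [set x : nat -> selection mode V |
    first_hit A k (voter x S0) /\ voter x S0 k = S1].
Proof.
move=> x y xy [[Ak nA] <-].
have e u : (u <= k)%N -> voter y S0 u = voter x S0 u.
  by move=> uk; apply: voter_agree => i iu; rewrite xy//; exact: leq_trans uk.
by split; [split=> [|u uk]|]; rewrite e//; [exact: nA|exact: ltnW].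
Qed.

(** * Restart at the first visit to [A], for general target sets [A] and [B] *)

Section StrongMarkov.
Context (R : realType) (V : finType) (mode : update_mode) (H : V -> V -> R)
  (d : measure_display) (T : measurableType d) (P : probability T R)
  (X : nat -> T -> selection mode V) (hX : voter_selections P H X)
  (A B : set (config V)) (S0 : config V).

Let run (k : nat) (C : config V) (w : T) : nat -> config V :=
  voter (fun i => X (k + i) w) C.

Let hit_at k C : set T := [set w | first_hit A k (run 0 S0 w) /\ run 0 S0 w k = C].

(** The restarted process needs more than [t] further rounds to reach [B]. *)
Let late k C t : set T := [set w | hit_at k C w /\ avoids B t (run k C w)].

Let measurable_avoids (A' : set (config V)) C t :
  measurable [set w | avoids A' t (run 0 C w)].
Proof. exact: (measurable_determined hX 0 (@determined_avoids V mode A' C t)). Qed.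

Let measurable_hit_at k C : measurable (hit_at k C).
Proof. exact: (measurable_determined hX 0 (@determined_first_hit V mode A S0 C k)). Qed.

Let measurable_late k C t : measurable (late k C t).
Proof.
have := measurable_determined hX 0 (determined_shift
  (@determined_first_hit V mode A S0 C k) (@determined_avoids V mode B C t)).
exact.
Qed.

Let P_late k C t : P (late k C t) =
  (P (hit_at k C) * P [set w | avoids B t (run 0 C w)])%E.
Proof.
exact: (probability_past_future hX
  (@determined_first_hit V mode A S0 C k) (@determined_avoids V mode B C t)).
Qed.

Let measurable_indicE (D : set T) : measurable D ->
  measurable_fun setT (fun w => (\1_D w : R)%:E).
Proof. by move=> mD; apply/measurable_EFinP; exact: measurable_indic. Qed.

Let hitting_time_seriesE (A' : set (config V)) C w :
  hitting_time R A' (run 0 C w) =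
  (\sum_(0 <= t <oo) (\1_[set w | avoids A' t (run 0 C w)] w)%:E)%E.
Proof. by rewrite hitting_time_series. Qed.

Lemma measurable_hitting_time (A' : set (config V)) C :
  measurable_fun setT (fun w => hitting_time R A' (voter (X^~ w) C)).
Proof.
apply: (eq_measurable_fun (fun w =>
  (\sum_(0 <= t <oo | t \in predT) (\1_[set w | avoids A' t (run 0 C w)] w)%:E)%E)).
  by move=> w _; rewrite hitting_time_seriesE.
apply: ge0_emeasurable_sum => [t w _ _|t _]; first by rewrite lee_fin.
exact: measurable_indicE.
Qed.

Lemma expected_time_series (A' : set (config V)) C :
  expected_time P X A' C =
  (\sum_(0 <= t <oo) P [set w | avoids A' t (voter (X^~ w) C)])%E.
Proof.
rewrite /expected_time; under eq_integral do rewrite hitting_time_seriesE.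
rewrite integral_nneseries//; last by move=> t; exact: measurable_indicE.
by apply: eq_eseriesr => t _; rewrite integral_indic// setIT.
Qed.

(* If [A] is first hit at time [k], the time that the process restarted at that
   moment takes to reach [B]; otherwise [0]. *)
Let excess k w := (\sum_(C : config V) \sum_(0 <= t <oo) (\1_(late k C t) w)%:E)%E
  : \bar R.

Let excess_ge0 k w : (0 <= excess k w)%E.
Proof. by apply: sume_ge0 => C _; apply: nneseries_ge0 => *; rewrite lee_fin. Qed.

Let measurable_lateness k C :
  measurable_fun setT (fun w => \sum_(0 <= t <oo) (\1_(late k C t) w : R)%:E)%E.
Proof.
apply: (eq_measurable_fun (fun w =>
  (\sum_(0 <= t <oo | t \in predT) (\1_(late k C t) w)%:E)%E)) => //.
apply: ge0_emeasurable_sum => [t w _ _|t _]; first by rewrite lee_fin.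
exact: measurable_indicE.
Qed.

Let measurable_excess k : measurable_fun setT (excess k).
Proof. exact: emeasurable_sum. Qed.

(** Sum and integral are exchanged by nonnegativity; [P_late] then factors each term, and the series
    of the second factors is an expected time. *)
Let integral_excess k : (\int[P]_w excess k w =
  \sum_(C : config V) P (hit_at k C) * expected_time P X B C)%E.
Proof.
rewrite ge0_integral_sum//=; last first.
  by move=> C w _; apply: nneseries_ge0 => *; rewrite lee_fin.
apply: eq_bigr => C _.
rewrite integral_nneseries//; last by move=> t; exact: measurable_indicE.
rewrite expected_time_series -[P (hit_at k C)]fineK ?fin_num_measure//.
rewrite -nneseriesZl//; apply: eq_eseriesr => t _.
rewrite integral_indic// setIT fineK ?fin_num_measure//; exact: P_late.
Qed.

Let hitting_time_le_excess w :
  (hitting_time R B (run 0 S0 w) <=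
   hitting_time R A (run 0 S0 w) + \sum_(0 <= k <oo) excess k w)%E.
Proof.
have ser0 : (0 <= \sum_(0 <= k <oo) excess k w)%E by apply: nneseries_ge0.
have [[k Ak]|nA] := first_hit_or_never A (run 0 S0 w); last first.
  by rewrite (hitting_time_never R nA) addye ?leey// gt_eqF// (lt_le_trans _ ser0).
rewrite (le_trans (hitting_time_shift_le R B k _))// (hitting_time_first_hit R Ak).
(* Of the whole series only the term at time [k] and configuration [run 0 S0 w k] is kept; it first
   enters in the partial sum of length [k.+1]. *)
rewrite leeD2l//; apply: le_trans (nneseries_lim_ge k.+1 _) => //.
rewrite big_nat_recr//=; apply: le_trans (leeDr _ _); last exact: sume_ge0.
rewrite /excess (bigD1 (run 0 S0 w k))//=; apply: le_trans (leeDl _ _).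
  rewrite hitting_time_series; apply: lee_nneseries => [t _ _|t _].
    by rewrite lee_fin.
  rewrite lee_fin !indicE.
  case: (boolP (_ \in _)) => // /set_mem av; rewrite mem_set//=.
  split=> [|u ut]; first by split.
  have := av u ut; rewrite /run /= voter_shift; exact.
by apply: sume_ge0 => C _; apply: nneseries_ge0 => *; rewrite lee_fin.
Qed.

(** The events are disjoint for distinct pairs (k, C). The sum falls short of 1 by the probability
    that [A] is never hit. *)
Let sum_hit_at_le1 : (\sum_(0 <= k <oo) \sum_(C : config V) P (hit_at k C) <= 1)%E.
Proof.
pose hit k := \bigcup_(C in [set C : config V | predT C]) hit_at k C.
have mhit k : measurable (hit k).
  apply: fin_bigcup_measurable => [|C _]; first exact: finite_finset.
  exact: measurable_hit_at.
have hitP k w : hit k w -> first_hit A k (run 0 S0 w) by move=> [C _ []].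
under eq_eseriesr => k _.
  rewrite -(@measure_bigcup_finType _ _ _ P _ predT); last 2 first.
  - by move=> C; exact: measurable_hit_at.
  - by move=> C C' _ _ [w [[_ <-] [_ <-]]].
  over.
rewrite -[leLHS](_ : P (\bigcup_(k in setT) hit k) = _).
  by apply: probability_le1; exact: bigcup_measurable.
rewrite measure_bigcup//; first by apply: eq_eseriesl => k; rewrite in_setT.
move=> k l _ _ [w [/hitP [Ak nk] /hitP [Al nl]]].
by case: (ltngtP k l) => // [/nl|/nk].
Qed.

Lemma expected_time_le_first_hit (c : \bar R) : (0 <= c)%E ->
  (forall C, A C -> (expected_time P X B C <= c)%E) ->
  (expected_time P X B S0 <= expected_time P X A S0 + c)%E.
Proof.
move=> c0 hc.
have EA0 : (0 <= expected_time P X A S0)%E.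
  by apply: integral_ge0 => w _; exact: hitting_time_ge0.
(* An infinite [c] makes the bound trivial; a finite one can be factored out of the series below. *)
case: c c0 hc => [c| |] // c0 hc; last first.
  by rewrite addey ?leey// gt_eqF// (lt_le_trans _ EA0).
have mser : measurable_fun setT (fun w => \sum_(0 <= k <oo) excess k w)%E.
  apply: (eq_measurable_fun (fun w =>
    (\sum_(0 <= k <oo | k \in predT) excess k w)%E)) => //.
  by apply: ge0_emeasurable_sum.
have ser0 w : (0 <= \sum_(0 <= k <oo) excess k w)%E by apply: nneseries_ge0.
apply: (@le_trans _ _ (\int[P]_w (hitting_time R A (voter (X^~ w) S0) +
    \sum_(0 <= k <oo) excess k w))%E).
  apply: ge0_le_integral => //.
  - by move=> w _; exact: hitting_time_ge0.
  - exact: measurable_hitting_time.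
  - by apply: emeasurable_funD => //; exact: measurable_hitting_time.
  - by move=> w _; exact: hitting_time_le_excess.
rewrite ge0_integralD//; last 2 first.
- by move=> w _; exact: hitting_time_ge0.
- exact: measurable_hitting_time.
rewrite leeD2l// integral_nneseries//.
apply: (@le_trans _ _ (\sum_(0 <= k <oo)
    c%:E * \sum_(C : config V) P (hit_at k C))%E).
  apply: lee_nneseries => [k _ _|k _]; first exact: integral_ge0.
  rewrite integral_excess ge0_sume_distrr//; apply: lee_sum => C _.
  (* The bound [hc] covers only [C] in [A]; for other [C] the event is empty, as the configuration
     at the first visit lies in [A]. *)
  have [AC|nAC] := pselect (A C); first by rewrite muleC lee_wpmul2r// hc.
  rewrite (_ : hit_at k C = set0) ?measure0 ?mul0e ?mule0//.
  by apply/seteqP; split=> // w [[+ _] e]; rewrite e.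
rewrite nneseriesZl => [|k _]; last exact: sume_ge0.
by rewrite -[leRHS]mule1 lee_wpmul2l// sum_hit_at_le1.
Qed.

End StrongMarkov.

Theorem lemma1 (R : realType) (V : finType) (E : rel V) (H : V -> V -> R)
    (hE : strongly_connected E) (hH : transition_matrix E H)
    (mode : update_mode)
    (d : measure_display) (T : measurableType d) (P : probability T R)
    (X : nat -> T -> selection mode V) (hX : voter_selections P H X)
    (f : nat -> \bar R) (hf0 : (0 <= f #|V|)%E)
    (hf : forall C : config V, no_agnostic C ->
        (expected_time P X (@consensus V) C <= f #|V|)%E)
    (S0 : config V) :
  (expected_time P X (@consensus V) S0 <=
   expected_time P X (@no_agnostic V) S0 + f #|V|)%E.
(* Here [A] is [no_agnostic] and [B] is [consensus], so restarts happen in classical configurations,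
   where [hf] applies. *)
Proof. exact: (expected_time_le_first_hit hX). Qed.
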